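(* Let $p$ be a prime and let $n$ be an integer with $2\le n\le p$. Then there exist nonzero classes $x\in H^{2p-3}(GL_n(\mathbb{F}_p);\mathbb{F}_p)$ and $y\in H^{2p-2}(GL_n(\mathbb{F}_p);\mathbb{F}_p)$ such that $y=\beta(x)$, where $\beta$ is the Bockstein homomorphism.
   Context: Cohomology is group cohomology of the finite group $GL_n(\mathbb{F}_p)$ with trivial coefficients. The Bockstein $\beta:H^i(-;\mathbb{F}_p)\to H^{i+1}(-;\mathbb{F}_p)$ is the connecting homomorphism associated with the short exact sequence $0\to\mathbb{Z}/p\to\mathbb{Z}/p^2\to\mathbb{Z}/p\to 0$. *)

(* Defs.v *)
From HB Require Import structures.
From mathcomp Require Import all_boot all_order all_fingroup all_algebra.
From mathcomp Require Import zify.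

Set Implicit Arguments.
Unset Strict Implicit.
Unset Printing Implicit Defensive.

Import GRing.Theory.
Local Open Scope ring_scope.

(* The group cohomology H^n(G; A) of a finite group with coefficients in a    *)
(* finite abelian group with trivial action is computed by the inhomogeneous  *)
(* bar complex: C^n(G; A) is the group of all functions G^n -> A, and         *)
(*   (d f)(g_1, ..., g_(n+1)) = f(g_2, ..., g_(n+1))                          *)
(*      + \sum_(1 <= k <= n) (-1)^k f(g_1, ..., g_k g_(k+1), ..., g_(n+1))    *)
(*      + (-1)^(n+1) f(g_1, ..., g_n).                                        *)

Notation cochain gT A n := {ffun (gT ^ n)%type -> A}.

Section Cochains.

Variable gT : finGroupType.

(* With the 0-based tuple g = (g 0, ..., g n), face 0 g drops g 0,            *)
(* face n.+1 g drops g n, and for 0 < k <= n, face k g replaces the two       *)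
(* entries g k.-1 and g k by their product.                                   *)
Definition face n (k : nat) (g : (gT ^ n.+1)%type) : (gT ^ n)%type :=
  [ffun i : 'I_n =>
     if (i.+1 < k)%N then g (inord i)
     else if i.+1 == k then (g (inord i) * g (inord i.+1))%g
     else g (inord i.+1)].

Definition differential (A : finZmodType) n (f : cochain gT A n) : cochain gT A n.+1 :=
  [ffun g => \sum_(k < n.+2) f (face k g) *~ (-1) ^+ k].

Lemma differential_is_zmod_morphism (A : finZmodType) n :
  zmod_morphism (@differential A n).
Proof.
move=> f h; apply/ffunP=> g; rewrite !ffunE -sumrB.
by apply: eq_bigr => k _; rewrite !ffunE mulrzBl.
Qed.
HB.instance Definition _ (A : finZmodType) n :=
  GRing.isZmodMorphism.Build _ _ (@differential A n)
    (@differential_is_zmod_morphism A n).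

Lemma face_face n (g : (gT ^ n.+2)%type) j k :
  (k < j <= n.+2)%N -> face k (face j g) = face j.-1 (face k g).
Proof.
move=> /andP[kj jn]; apply/ffunP=> i; have ilt := ltn_ord i; rewrite !ffunE.
have i1 : (inord i : 'I_n.+1) = i :> nat by rewrite inordK //; lia.
have i2 : (inord i.+1 : 'I_n.+1) = i.+1 :> nat by rewrite inordK //; lia.
rewrite !i1 !i2.
case: j kj jn => // j kj jn; rewrite /= !ltnS !eqSS.
case: (ltngtP i.+1 k) => ?; case: (ltngtP i.+2 k) => ?;
  case: (ltngtP i.+1 j) => ?; case: (ltngtP i j) => ?;
  by [exfalso; lia | rewrite ?mulgA].
Qed.

Lemma alternating_sum0 (A : zmodType) m (s : nat -> nat -> A) :
  (forall j k, (k < j <= m)%N -> s j k = - s k j.-1) ->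
  \sum_(j < m.+1) \sum_(k < m) s j k = 0.
Proof.
elim: m s => [|m IHm] s sN.
  by rewrite big1 // => j _; rewrite big_ord0.
rewrite big_ord_recr /=.
under eq_bigr do rewrite big_ord_recr /=.
rewrite big_split /= IHm ?add0r; last first.
  by move=> j k /andP[kj jm]; apply: sN; rewrite kj leqW.
rewrite -big_split big1 //= => k _.
by rewrite [s m.+1 k]sN ?subrr //= ltn_ord leqnn.
Qed.

Lemma differentialK (A : finZmodType) n (f : cochain gT A n) : differential (differential f) = 0.
Proof.
apply/ffunP=> g; rewrite !ffunE.
under eq_bigr do rewrite ffunE mulrz_suml.
pose s j k := f (face k (face j g)) *~ (-1) ^+ k *~ (-1) ^+ j.
apply: (@alternating_sum0 _ _ s) => j k kj; rewrite /s face_face //.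
case: j kj => // j _.
by rewrite -!mulrzA -!exprD /= addnS addnC exprS mulN1r mulrNz.
Qed.

End Cochains.

Section Cohomology.

Variables (gT : finGroupType) (A : finZmodType).

Definition closed_cochain n : {pred cochain gT A n} :=
  fun f => differential f == 0.

Definition exact_cochain n : {pred cochain gT A n} :=
  match n with
  | 0 => pred1 0
  | m.+1 => [pred f | f \in codom (@differential gT A m)]
  end.

Lemma closed_zmod_closed n : zmod_closed (@closed_cochain n).
Proof.
split=> [|f h]; rewrite !unfold_in ?raddf0 // => /eqP df /eqP dh.
by rewrite raddfB /= df dh subrr.
Qed.
HB.instance Definition _ n :=
  GRing.isZmodClosed.Build _ (@closed_cochain n) (@closed_zmod_closed n).

Lemma exact_zmod_closed n : zmod_closed (@exact_cochain n).
Proof.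
case: n => [|n]; split=> [|f h]; rewrite !unfold_in //=.
- by move=> /eqP-> /eqP->; rewrite subrr.
- by apply/codomP; exists 0; rewrite raddf0.
- by move=> /codomP[f' ->] /codomP[h' ->]; rewrite -raddfB; apply: codom_f.
Qed.
HB.instance Definition _ n :=
  GRing.isZmodClosed.Build _ (@exact_cochain n) (@exact_zmod_closed n).

Lemma exact_closed n (f : cochain gT A n.+1) :
  f \in @exact_cochain n.+1 -> f \in @closed_cochain n.+1.
Proof. by rewrite !unfold_in /= => /codomP[h ->]; rewrite differentialK. Qed.

Record cocycle n := Cocycle {
  cocycle_val :> cochain gT A n;
  cocycleP : cocycle_val \in @closed_cochain n }.
HB.instance Definition _ n := [isSub for @cocycle_val n].
HB.instance Definition _ n := [Choice of cocycle n by <:].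
HB.instance Definition _ n := [SubChoice_isSubZmodule of cocycle n by <:].

Definition coboundary n : {pred cocycle n} := fun z => val z \in @exact_cochain n.

Lemma coboundaryE n (z : cocycle n) :
  (z \in @coboundary n) = (val z \in @exact_cochain n).
Proof. by []. Qed.

Lemma coboundary_zmod_closed n : zmod_closed (@coboundary n).
Proof.
split=> [|z w]; rewrite !coboundaryE; first by rewrite raddf0 rpred0.
by move=> ? ?; rewrite raddfB rpredB.
Qed.
HB.instance Definition _ n :=
  GRing.isZmodClosed.Build _ (@coboundary n) (@coboundary_zmod_closed n).

Definition cohomology n := Quotient.quot (@coboundary n).
HB.instance Definition _ n := GRing.Zmodule.on (cohomology n).

Definition cohomology_class n (z : cocycle n) : cohomology n :=
  \pi_(Quotient.quot (@coboundary n))%qT z.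

Lemma cohomology_class_eq n (z w : cocycle n) :
  (cohomology_class z == cohomology_class w) = (z - w \in @coboundary n).
Proof. by rewrite Quotient.idealrBE. Qed.

End Cohomology.

Notation "''H^' n ( G ; A )" := (cohomology G A n)
  (at level 8, n at level 2, format "''H^' n ( G ;  A )") : type_scope.

Definition cohomology_cast (gT : finGroupType) (A : finZmodType) m n
  (e : m = n) (x : cohomology gT A m) : cohomology gT A n :=
  ecast k (cohomology gT A k) e x.

Record short_exact (A B C : zmodType) (i : A -> B) (r : B -> C) : Prop :=
  ShortExact {
    ses_inj : injective i;
    ses_exact : forall b, r b = 0 <-> exists a, i a = b;
    ses_surj : forall c, exists b, r b = c }.

(* The connecting homomorphism H^n(G; C) -> H^(n+1)(G; A) of a short exact    *)
(* sequence 0 -> A -> B -> C -> 0 of coefficients: represent a class by a     *)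
(* cocycle, lift it to a B-valued cochain, take the differential of the lift, *)
(* and pull the result back to an A-valued cocycle. By connecting_classE, the *)
(* class obtained does not depend on these choices.                           *)
Section Connecting.

Variables (gT : finGroupType) (A B C : finZmodType).
Variables (i : {additive A -> B}) (r : {additive B -> C}).
Hypothesis ex : short_exact i r.

Definition cochain_map (D E : finZmodType) (u : D -> E) n (f : cochain gT D n) :
  cochain gT E n := [ffun g => u (f g)].

Lemma cochain_map_differential (D E : finZmodType) (u : {additive D -> E}) n
    (f : cochain gT D n) :
  differential (cochain_map u f) = cochain_map u (differential f).
Proof.
apply/ffunP=> g; rewrite !ffunE raddf_sum.
by apply: eq_bigr => k _; rewrite ffunE raddfMz.
Qed.

Lemma cochain_mapB (D E : finZmodType) (u : {additive D -> E}) n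
    (f h : cochain gT D n) :
  cochain_map u (f - h) = cochain_map u f - cochain_map u h.
Proof. by apply/ffunP=> g; rewrite !ffunE raddfB. Qed.

Lemma cochain_map_inj n : injective (@cochain_map A B i n).
Proof.
by move=> f h /ffunP fh; apply/ffunP=> g; move: (fh g);
   rewrite !ffunE => /(ses_inj ex).
Qed.

Lemma cochain_lift n (f : cochain gT C n) : exists F, cochain_map r F == f.
Proof.
have rP c : exists b, r b == c by have [b <-] := ses_surj ex c; exists b.
exists [ffun g => xchoose (rP (f g))]; apply/eqP/ffunP=> g.
by rewrite !ffunE; apply/eqP/(xchooseP (rP _)).
Qed.

Lemma cochain_pullback n (F : cochain gT B n) :
  cochain_map r F = 0 -> exists h, cochain_map i h == F.
Proof.
move=> rF.
have iP g : exists a, i a == F g.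
  have /(ses_exact ex)[a <-] : r (F g) = 0.
    by move/ffunP/(_ g): rF; rewrite !ffunE.
  by exists a.
exists [ffun g => xchoose (iP g)]; apply/eqP/ffunP=> g.
by rewrite !ffunE; apply/eqP/(xchooseP (iP g)).
Qed.

Lemma connecting_exists n (z : cocycle gT C n) :
  exists h, cochain_map i h ==
            differential (xchoose (cochain_lift z)).
Proof.
apply: cochain_pullback; rewrite -cochain_map_differential.
by rewrite (eqP (xchooseP (cochain_lift z))); apply/eqP/cocycleP.
Qed.

Lemma pullback_closed n (F : cochain gT B n) (h : cochain gT A n.+1) :
  cochain_map i h = differential F -> h \in @closed_cochain gT A n.+1.
Proof.
move=> hF; rewrite unfold_in; apply/eqP/cochain_map_inj.
rewrite -cochain_map_differential hF differentialK.
by apply/ffunP=> g; rewrite !ffunE raddf0.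
Qed.

Definition connecting_cocycle n (z : cocycle gT C n) : cocycle gT A n.+1 :=
  Cocycle (pullback_closed (eqP (xchooseP (connecting_exists z)))).

Definition connecting n (x : 'H^n(gT; C)) : 'H^n.+1(gT; A) :=
  cohomology_class (connecting_cocycle (generic_quotient.repr x)).

Lemma connecting_classE n (z : cocycle gT C n) (F : cochain gT B n)
    (h : cocycle gT A n.+1) :
  cochain_map r F = z -> cochain_map i h = differential F ->
  connecting (cohomology_class z) = cohomology_class h.
Proof.
move=> rF ih; rewrite /connecting; set w := generic_quotient.repr _.
have : cohomology_class w == cohomology_class z.
  by rewrite /cohomology_class reprK.
set h' := connecting_cocycle w; have [F' rF' ih'] : exists2 F' : cochain gT B n,
    cochain_map r F' = w & cochain_map i h' = differential F'.
  exists (xchoose (cochain_lift w)); first exact/eqP/(xchooseP (cochain_lift w)).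
  exact/eqP/(xchooseP (connecting_exists w)).
rewrite cohomology_class_eq => wz; clearbody h' w.
apply/eqP; rewrite cohomology_class_eq.
have [G dG rG] : exists2 G : cochain gT B n,
    differential G = 0 & cochain_map r G = w - z :> cochain gT C n.
  case: n z F h w h' F' rF ih rF' ih' wz => [|m] z F h w h' F' rF ih rF' ih'.
    rewrite coboundaryE raddfB => /eqP/= ->.
    exists 0; first by rewrite raddf0.
    by apply/ffunP=> g; rewrite !ffunE raddf0.
  rewrite coboundaryE raddfB => /codomP[u /= ->].
  have [U /eqP rU] := cochain_lift u.
  exists (differential U).
    by rewrite differentialK.
  by rewrite -cochain_map_differential rU.
have [k /eqP ik] : exists k, cochain_map i k == F' - F - G.
  by apply: cochain_pullback; rewrite !cochain_mapB rF rF' rG subrr.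
rewrite coboundaryE raddfB; apply/codomP; exists k.
apply: cochain_map_inj; rewrite /= cochain_mapB ih ih'.
by rewrite -cochain_map_differential ik !raddfB /= dG subr0.
Qed.

Lemma connecting_is_zmod_morphism n : zmod_morphism (@connecting n).
Proof.
suff repP (x : 'H^n(gT; C)) : exists z F (h : cocycle gT A n.+1),
    [/\ x = cohomology_class z, cochain_map r F = z
      & cochain_map i h = differential F].
  move=> x y; have [z [F [h [-> rF ih]]]] := repP x.
  have [w [K [l [-> rK il]]]] := repP y.
  rewrite (connecting_classE rF ih) (connecting_classE rK il).
  rewrite /cohomology_class -!raddfB -/(cohomology_class _).
  by apply: (connecting_classE (F := F - K));
     rewrite ?cochain_mapB ?raddfB /= ?cochain_mapB ?rF ?rK ?ih ?il.
exists (generic_quotient.repr x), (xchoose (cochain_lift (generic_quotient.repr x))), (connecting_cocycle (generic_quotient.repr x)).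
split; first by rewrite /cohomology_class reprK.
  exact/eqP/(xchooseP (cochain_lift _)).
exact/eqP/(xchooseP (connecting_exists _)).
Qed.
HB.instance Definition _ n :=
  GRing.isZmodMorphism.Build _ _ (@connecting n) (@connecting_is_zmod_morphism n).

End Connecting.

Section Bockstein.

Variables (p : nat) (p_pr : prime p).

(* The maps a |-> p a and b |-> b mod p of 0 -> Z/p -> Z/p^2 -> Z/p -> 0.     *)
(* 'F_p is the ring of integers modulo pdiv p, so they are additive only      *)
(* because p is prime.                                                        *)
Definition coef_incl of prime p : 'F_p -> 'Z_(p ^ 2) :=
  fun a => (p * a)%:R.
Definition coef_proj of prime p : 'Z_(p ^ 2) -> 'F_p :=
  fun b => (b : nat)%:R.

Let p_gt1 : (1 < p)%N. Proof. exact: prime_gt1. Qed.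
Let p2_gt1 : (1 < p ^ 2)%N. Proof. by rewrite (ltn_exp2l 0). Qed.

Lemma coef_incl_nat m : coef_incl p_pr m%:R = (p * m)%:R.
Proof.
rewrite /coef_incl val_Fp_nat // -(Zp_nat_mod p2_gt1) -[RHS](Zp_nat_mod p2_gt1).
by rewrite muln_modr -mulnn modn_mod.
Qed.

Lemma coef_proj_nat m : coef_proj p_pr m%:R = m%:R.
Proof.
rewrite /coef_proj val_Zp_nat // -(Fp_nat_mod p_pr) modn_dvdm ?Fp_nat_mod //.
exact: dvdn_exp.
Qed.

Lemma coef_incl_is_zmod_morphism : zmod_morphism (coef_incl p_pr).
Proof.
have fD x y : coef_incl p_pr (x + y) = coef_incl p_pr x + coef_incl p_pr y.
  by rewrite -[x]natr_Zp -[y]natr_Zp -natrD !coef_incl_nat mulnDr natrD.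
by move=> a b; rewrite -[a in RHS](subrK b a) [in RHS]fD addrK.
Qed.
HB.instance Definition _ :=
  GRing.isZmodMorphism.Build _ _ (coef_incl p_pr) coef_incl_is_zmod_morphism.

Lemma coef_proj_is_zmod_morphism : zmod_morphism (coef_proj p_pr).
Proof.
have fD x y : coef_proj p_pr (x + y) = coef_proj p_pr x + coef_proj p_pr y.
  by rewrite -[x]natr_Zp -[y]natr_Zp -natrD !coef_proj_nat natrD.
by move=> a b; rewrite -[a in RHS](subrK b a) [in RHS]fD addrK.
Qed.
HB.instance Definition _ :=
  GRing.isZmodMorphism.Build _ _ (coef_proj p_pr) coef_proj_is_zmod_morphism.

Lemma bockstein_short_exact : short_exact (coef_incl p_pr) (coef_proj p_pr).
Proof.
have p_gt0 := prime_gt0 p_pr.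
split=> [a a' /(congr1 val)|b|c].
- rewrite /coef_incl /= !val_Zp_nat // -mulnn -!muln_modr => /eqP.
  rewrite eqn_pmul2l // => /eqP.
  by rewrite -!(val_Fp_nat p_pr) !natr_Zp => /val_inj.
- split=> [/(congr1 val)|[a <-]].
    rewrite /coef_proj /= val_Fp_nat // => /eqP /dvdnP[m bE].
    by exists m%:R; rewrite coef_incl_nat mulnC -bE natr_Zp.
  rewrite /coef_incl coef_proj_nat natrM.
  by rewrite (pchar_Fp_0 p_pr) mul0r.
- by exists (val c)%:R; rewrite coef_proj_nat natr_Zp.
Qed.

Definition bockstein (gT : finGroupType) n :
    'H^n(gT; 'F_p) -> 'H^n.+1(gT; 'F_p) :=
  @connecting gT _ _ _ (coef_incl p_pr) (coef_proj p_pr) bockstein_short_exact n.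
HB.instance Definition _ gT n :=
  GRing.Additive.on (@bockstein gT n).

End Bockstein.

Lemma bockstein_degree p : prime p -> ((2 * p - 3).+1 = 2 * p - 2)%N.
Proof. by move=> /prime_gt1; lia. Qed.

(* Main.v *)
Require Import Defs.
From mathcomp Require Import all_boot all_order all_fingroup all_algebra.
From mathcomp Require Import cyclic pgroup sylow finfield zify ring.

(* Let a finite group G act on a finite set X from the right, and let         *)
(* c : X * G -> F_p satisfy c(x, gh) = c(x, g) + c(xg, h); it is a functor    *)
(* from the action groupoid of X to F_p. Pulling a cocycle on F_p back along  *)
(* c and summing over X (the transfer of the covering X//G -> BG) is a chain  *)
(* map. On F_p let e be the residue in [0, p) and z the carry cocycle, so     *)
(* that d e = p z over the integers. Then d(e z^(p-2)) = p z^(p-1), hence the *)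
(* Bockstein maps the transfer of e z^(p-2) to the transfer of z^(p-1).       *)
(*   The latter is detected by an element u with u^p = 1: pair it with the    *)
(* mod p cycle \sum_k (u^k_1, u, u^k_2, u, ..., u^k_(p-1), u). Free u-orbits  *)
(* contribute 0 mod p, and a fixed point x contributes c(x, u)^(p-1), so the  *)
(* pairing counts the x with xu = x and c(x, u) <> 0.                         *)
(*   For G = GL_n(F_p) take the pairs (v, w mod v) of row vectors, with       *)
(* c(x, g) the multiple of vg by which the chosen lifts of w to F_p^n differ, *)
(* and u a single unipotent Jordan block; u^p = 1 because n <= p. The count   *)
(* is (p-1)^2, which is 1 mod p.                                              *)

Set Implicit Arguments.
Unset Strict Implicit.
Unset Printing Implicit Defensive.

Import GRing.Theory.
Local Open Scope ring_scope.

(** A coboundary pairs to zero with a mod p cycle, so one nonzero pairing shows y is nonzero, and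
    then x is nonzero because the Bockstein is additive. That y is a Bockstein is formal:
    [bockstein_transfer] holds for every G-set X, every c and every degree 2m+2. By
    [transfer_pairing] the pairing is the sum of c(x, u)^(m+1) over the fixed points x of u. For m+1
    = p-1 Fermat turns each power into the indicator of c(x, u) <> 0, which singles out the degree
    2p-2. In GL_n, u fixes e_0 and sends e_1 to e_1 + e_0, so exactly the pairs (a e_0, b e_1) with
    a and b nonzero contribute ([sum_pair_slope]); two coordinates are needed for this, and n <= p
    gives u^p = 1. *)

Section SequenceFaces.

Variable T : Type.

(** The padding [d] past position [n] is invisible to anything [local_on n]. *)
Definition extend (d : T) n (g : (T ^ n)%type) (i : nat) : T :=
  oapp g d (insub i).

Lemma extend_ord d n (g : (T ^ n)%type) (i : 'I_n) : extend d g i = g i.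
Proof. by rewrite /extend valK. Qed.

(* The formula of face for a sequence of unbounded length: a cochain of       *)
(* degree n is then a function of the sequence that is local on n, and no     *)
(* dependent index occurs.                                                    *)
Definition seq_face (op : T -> T -> T) (k : nat) (a : nat -> T) (i : nat) : T :=
  if (i.+1 < k)%N then a i else if i.+1 == k then op (a i) (a i.+1) else a i.+1.

Definition local_on (R : Type) n (phi : (nat -> T) -> R) :=
  forall a b : nat -> T, (forall i, (i < n)%N -> a i = b i) -> phi a = phi b.

End SequenceFaces.

Lemma extend_face (gT : finGroupType) n k (g : (gT ^ n.+1)%type) i : (i < n)%N ->
  extend 1%g (face k g) i = seq_face *%g k (extend 1%g g) i.
Proof.
move=> i_n; have gE j : (j < n.+1)%N -> extend 1%g g j = g (inord j).
  by move=> j_n; rewrite -{1}(inordK j_n) extend_ord.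
rewrite -[i in LHS](inordK (n' := n.-1)); last by lia.
case: n k g i_n gE => // n k g i_n gE.
by rewrite extend_ord ffunE inordK // /seq_face !gE //; lia.
Qed.

Definition seq_differential (V A : zmodType) n (phi : (nat -> V) -> A) (a : nat -> V) : A :=
  \sum_(k < n.+2) phi (seq_face +%R k a) *~ (-1) ^+ k.

(** * Transfer of cochains pulled back along c *)

Section Transfer.

Variables (gT : finGroupType) (X : finType) (V : zmodType).
Variables (to : X -> gT -> X) (c : X -> gT -> V).
Hypothesis to1 : forall x, to x 1%g = x.
Hypothesis toM : forall x g h, to x (g * h)%g = to (to x g) h.
Hypothesis cM : forall x g h, c x (g * h)%g = c x g + c (to x g) h.

Definition prefix_prod (g : nat -> gT) i := (\prod_(j < i) g j)%g.

(** The increments of [c] along the path x, x g_0, x g_0 g_1, ...: the map of bar complexes induced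
    by the functor [c]. *)
Definition labels x (g : nat -> gT) i := c (to x (prefix_prod g i)) (g i).

Lemma prefix_prodS g i : prefix_prod g i.+1 = (prefix_prod g i * g i)%g.
Proof. by rewrite /prefix_prod big_ord_recr. Qed.

Lemma prefix_prod_faceS g k i :
  prefix_prod (seq_face *%g k.+1 g) i = prefix_prod g (i + (k < i)%N).
Proof.
elim: i => [|i IHi]; first by rewrite ltn0 addn0 /prefix_prod !big_ord0.
rewrite prefix_prodS IHi /seq_face !ltnS eqSS.
case: (ltngtP i k) => ik /=; rewrite ?addn0 ?addn1 ?addSn ?addn0 ?prefix_prodS //.
by rewrite mulgA.
Qed.

Lemma labels_faceS x g k i :
  labels x (seq_face *%g k.+1 g) i = seq_face +%R k.+1 (labels x g) i.
Proof.
rewrite /labels prefix_prod_faceS /seq_face !ltnS eqSS.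
case: (ltngtP i k) => ik; rewrite /= ?addn0 ?addn1 //.
by rewrite cM prefix_prodS toM.
Qed.

Lemma labels_face0 x g i :
  labels (to x (g 0%N)) (seq_face *%g 0 g) i = seq_face +%R 0 (labels x g) i.
Proof.
rewrite /labels -toM /seq_face /=; congr (c (to _ _) _).
by rewrite /prefix_prod big_ord_recl.
Qed.

Lemma eq_labels x g h i : (forall j, (j <= i)%N -> g j = h j) ->
  labels x g i = labels x h i.
Proof.
move=> gh; rewrite /labels gh // /prefix_prod.
by under eq_bigr => j _ do rewrite gh ?(ltnW (ltn_ord j)) //.
Qed.

Definition transfer (A : finZmodType) n (phi : (nat -> V) -> A) : cochain gT A n :=
  [ffun g => \sum_x phi (labels x (extend 1%g g))].

(** Every face but the face 0 commutes with [labels] at a fixed x; the face 0 moves the base point,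
    which the sum over X absorbs. *)
Lemma differential_transfer (A : finZmodType) n (phi : (nat -> V) -> A) :
  local_on n phi ->
  differential (transfer n phi) = transfer n.+1 (seq_differential n phi).
Proof.
move=> phi_loc; apply/ffunP=> g; rewrite !ffunE exchange_big /=.
apply: eq_bigr => k _; rewrite ffunE -mulrz_suml; congr (_ *~ _).
case: k => -[|k] /= _; last first.
  apply: eq_bigr => x _; apply: phi_loc => i i_n; rewrite -labels_faceS.
  by apply: eq_labels => j ji; rewrite extend_face // (leq_ltn_trans ji).
have toK h : cancel (to^~ h) (to^~ h^-1%g) by move=> x; rewrite -toM mulgV to1.
rewrite (reindex_inj (can_inj (toK (extend 1%g g 0%N)))).
apply: eq_bigr => x _; apply: phi_loc => i i_n; rewrite -labels_face0.
by apply: eq_labels => j ji; rewrite extend_face // (leq_ltn_trans ji).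
Qed.

End Transfer.

(** * The carry cocycle and its cup powers *)

Section Carry.

Variable p : nat.

Definition carry (a b : 'F_p) : nat := (((a : nat) + b) %/ p)%N.

(** The m-fold cup power of the carry cocycle, kept in [nat] so that it can be cast to both Z/p and
    Z/p^2. *)
Definition carry_power m (a : nat -> 'F_p) : nat :=
  \prod_(j < m) carry (a (2 * j)%N) (a (2 * j).+1).

(* The integral lift of e z^m. *)
Definition residue_carry_power m (a : nat -> 'F_p) : nat :=
  ((a 0%N : nat) * carry_power m (fun i => a i.+1))%N.

Lemma carry_power_local m : local_on (2 * m) (carry_power m).
Proof.
move=> a b ab; apply: eq_bigr => j _.
by have j_m := ltn_ord j; rewrite !ab //; lia.
Qed.

Lemma residue_carry_power_local m :
  local_on (2 * m).+1 (residue_carry_power m).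
Proof.
move=> a b ab; rewrite /residue_carry_power ab //; congr (_ * _)%N.
by apply: carry_power_local => i i_m; rewrite ab.
Qed.

Hypothesis p_pr : prime p.

Lemma carryP (a b : 'F_p) : ((a : nat) + b = p * carry a b + (a + b)%R)%N.
Proof.
rewrite [LHS](divn_eq _ p) mulnC; congr (_ + _)%N.
by rewrite -val_Fp_nat // natrD !natr_Zp.
Qed.

(** Multiplied by p, either side is the integer a + b + d minus the residue of that sum. *)
Lemma carry_cocycle (a b d : 'F_p) :
  (carry b d + carry a (b + d)%R = carry (a + b)%R d + carry a b)%N.
Proof.
have := carryP b d; have := carryP a (b + d); have := carryP (a + b) d.
have := carryP a b; rewrite addrA => e1 e2 e3 e4.
apply/eqP; rewrite -(eqn_pmul2l (prime_gt0 p_pr)) !mulnDr.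
rewrite -(eqn_add2r (a + b + d)%R) -addnA -e3 addnCA -e4 addnAC -e2.
by rewrite eq_sym addnC addnA -e1 addnA.
Qed.

Lemma carry_powerS m a :
  carry_power m.+1 a = (carry (a 0%N) (a 1%N) * carry_power m (fun i => a i.+2))%N.
Proof.
rewrite /carry_power big_ord_recl; congr (_ * _)%N; apply: eq_bigr => j _.
by rewrite /= !mulnS.
Qed.

Variable R : comNzRingType.

(** Leibniz rule by induction. The faces from 3 on act past the first two entries, and their sum
    collapses to [- carry (a 0) (a 1)] times the remaining power; together with the faces 0, 1, 2
    this is [carry_cocycle]. *)
Lemma carry_power_closed m (a : nat -> 'F_p) :
  seq_differential (2 * m) (fun b => (carry_power m b)%:R : R) a = 0.
Proof.
rewrite /seq_differential; elim: m a => [|m IHm] a.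
  by rewrite muln0 !big_ord_recl big_ord0 /carry_power !big_ord0 /= addr0 subrr.
rewrite mulnS 3!big_ord_recl; set S := \sum_(i < _) _.
have /eqP := IHm (fun i => a i.+2).
rewrite big_ord_recl addr_eq0 => /eqP IH.
have -> : S = (carry (a 0%N) (a 1%N))%:R *
    \sum_(i < (2 * m).+1) (carry_power m (seq_face +%R (lift ord0 i)
       (fun i => a i.+2)))%:R *~ (-1) ^+ lift ord0 i.
  rewrite mulr_sumr; apply: eq_bigr => i _.
  rewrite carry_powerS /= /bump !add1n natrM.
  by rewrite -mulrzAr 2!exprS !mulN1r opprK.
rewrite -[\sum_(i < _) _]opprK -IH !carry_powerS /=.
rewrite mulrN !natrM.
have /(congr1 (fun m => m%:R : R)) := carry_cocycle (a 0%N) (a 1%N) (a 2%N).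
rewrite /seq_face /= !natrD => co.
set P := (carry_power m _)%:R.
rewrite !mulr1z ?mulrN1z /bump /= ?expr2 ?mulN1r ?opprK ?mulr1z ?mulrN1z.
have {co} -> : (carry (a 1%N) (a 2%N))%:R = (carry (a 0%N + a 1%N)%R (a 2%N))%:R +
   (carry (a 0%N) (a 1%N))%:R - (carry (a 0%N) (a 1%N + a 2%N)%R)%:R :> R.
  by rewrite -co addrK.
ring.
Qed.

(** d(e z^m) = (de) z^m - e d(z^m), where d(z^m) = 0 and de = p z by [carryP]. *)
Lemma residue_carry_power_differential m (a : nat -> 'F_p) :
  seq_differential (2 * m).+1 (fun b => (residue_carry_power m b)%:R : R) a =
  (p * carry_power m.+1 a)%:R.
Proof.
rewrite /seq_differential 2!big_ord_recl; set S := \sum_(i < _) _.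
have /eqP := carry_power_closed m (fun i => a i.+1).
rewrite /seq_differential big_ord_recl addr_eq0 => /eqP IH.
have -> : S = - (a 0%N : nat)%:R *
    \sum_(i < (2 * m).+1) (carry_power m (seq_face +%R (lift ord0 i)
       (fun i => a i.+1)))%:R *~ (-1) ^+ lift ord0 i.
  rewrite mulr_sumr; apply: eq_bigr => i _.
  rewrite /residue_carry_power /= /bump !add1n natrM.
  rewrite -mulrzAr mulNr -mulrN -mulrNz; congr (_ * (_ *~ _)).
  by rewrite exprS mulN1r.
rewrite -[\sum_(i < _) _]opprK -IH carry_powerS /residue_carry_power /=.
rewrite mulNr mulrN opprK !natrM.
rewrite /seq_face /=.
set P := (carry_power m _)%:R.
rewrite !mulr1z mulrN1z.
have /(congr1 (fun m => m%:R : R)) := carryP (a 0%N) (a 1%N).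
rewrite !natrD natrM => co.
by rewrite mulrA -[p%:R * _](addrK (a 0%N + a 1%N)%R%:R) -co; ring.
Qed.

End Carry.

(** * The Bockstein of a transfer *)

Lemma bockstein_transfer (p : nat) (p_pr : prime p) (gT : finGroupType)
    (X : finType) (to : X -> gT -> X) (c : X -> gT -> 'F_p) m :
  (forall x, to x 1%g = x) ->
  (forall x g h, to x (g * h)%g = to (to x g) h) ->
  (forall x g h, c x (g * h)%g = c x g + c (to x g) h) ->
  exists (x : 'H^(2 * m).+1(gT; 'F_p)) (h : cocycle gT 'F_p (2 * m).+2),
    bockstein p_pr x = cohomology_class h /\
    val h = transfer to c (2 * m).+2 (fun a => (carry_power m.+1 a)%:R).
Proof.
move=> to1 toM cM; set t := transfer _ _ _ _.
pose F : cochain gT 'Z_(p ^ 2) (2 * m).+1 :=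
  transfer to c _ (fun a => (residue_carry_power m a)%:R).
have dF : cochain_map (coef_incl p_pr) t = differential F.
  rewrite differential_transfer //; last first.
    by move=> a b ab; rewrite (residue_carry_power_local ab).
  apply/ffunP=> g; rewrite !ffunE raddf_sum; apply: eq_bigr => x _.
  by rewrite residue_carry_power_differential //; apply: coef_incl_nat.
(* Modulo p the lift [F] is a cocycle, its differential being in the image of multiplication by
   p. *)
have F_closed : differential (cochain_map (coef_proj p_pr) F) == 0.
  rewrite cochain_map_differential -dF; apply/eqP/ffunP=> g; rewrite !ffunE.
  by apply/(ses_exact (bockstein_short_exact p_pr)); exists (t g); rewrite !ffunE.
pose z : cocycle gT 'F_p _ := Cocycle F_closed.
pose h := Cocycle (pullback_closed (bockstein_short_exact p_pr) dF).
by exists (cohomology_class z), h; split=> //; apply: (connecting_classE _ (F := F)).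
Qed.

(** * Counting modulo p by fixed points *)

Section FixedPoints.

Variables (p : nat) (p_pr : prime p) (T : finType) (s : T -> T).
Hypothesis s_iter : iter p s =1 id.

(** Each level set of [F] is stable under a p-group generated by [s], so its size is congruent to
    its number of fixed points. *)
Lemma sum_fixed_points (F : T -> 'F_p) : (forall x, F (s x) = F x) ->
  \sum_x F x = \sum_(x | s x == x) F x.
Proof.
move=> Fs.
have s_inj : injective s.
  apply: (can_inj (g := iter p.-1 s)) => x.
  by rewrite -iterSr prednK ?prime_gt0 ?s_iter.
pose ps := perm s_inj.
have ps_group : (p.-group <[ps]>)%g.
  apply: (@pnat_dvd _ p); last by rewrite pnat_id.
  rewrite -[#|_|]/(#[ps]%g) order_dvdn; apply/eqP/permP=> x.
  rewrite permX perm1 -[RHS]s_iter; apply: eq_iter => y; exact: permE.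
have card_level a : #|[pred x | F x == a]|%:R =
                    #|[pred x | (s x == x) && (F x == a)]|%:R :> 'F_p.
  pose A := [set x | F x == a].
  have A_acts : ([acts <[ps]>, on A | 'P])%g.
    rewrite cycle_subG; apply/astabsP=> x.
    by rewrite /= apermE permE !inE Fs.
  have A_card := pgroup_fix_mod ps_group A_acts.
  have -> : #|[pred x | F x == a]| = #|A| by apply: eq_card => x; rewrite !inE.
  have -> : #|[pred x | (s x == x) && (F x == a)]| = #|'Fix_(A | 'P)(<[ps]>)%g|.
    apply: eq_card => x; rewrite afix_cycle inE in_setI [in RHS]inE andbC.
    by congr (_ && _); apply/eqP/afix1P; rewrite /= apermE permE.
  by apply/eqP; rewrite -(Fp_nat_mod p_pr) A_card Fp_nat_mod.
rewrite (partition_big F predT) // [RHS](partition_big F predT) //=.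
apply: eq_bigr => a _.
rewrite (eq_bigr (fun=> a)); last by move=> x /eqP.
rewrite [RHS](eq_bigr (fun=> a)); last by move=> x /andP[_ /eqP].
by rewrite !sumr_const -mulr_natr card_level mulr_natr.
Qed.

End FixedPoints.

(** * A mod p cycle of the cyclic group of u, and its pairing with transfers *)

Section BarCycle.

Variables (p : nat) (p_pr : prime p) (gT : finGroupType) (u : gT).
Hypothesis u_p : (u ^+ p = 1)%g.

Lemma expg_Fp_add (a b : 'F_p) : (u ^+ (a + b)%R = u ^+ a * u ^+ b)%g.
Proof. by rewrite -expgD (carryP p_pr) expgD expgM u_p expg1n mul1g. Qed.

Lemma expg_Fp1 : (u ^+ (1 : 'F_p)%R = u)%g.
Proof. by rewrite -[1]/(1%:R) val_Fp_nat // modn_small ?prime_gt1. Qed.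

Definition bar_word (k : nat -> 'F_p) (i : nat) : gT :=
  if odd i then u else (u ^+ k i./2)%g.

Definition bar_tuple m n (k : {ffun 'I_m -> 'F_p}) : (gT ^ n)%type :=
  [ffun i : 'I_n => bar_word (extend 0 k) i].

(** The face 2j+1 merges u^(k_j) with the u after it, the face 2j+2 merges that u with u^(k_(j+1));
    moving one unit of exponent from k_(j+1) to k_j makes the results agree. For j = m-1 the face
    2j+2 just drops the last u, and the correction at j+1 is out of range. *)
Lemma face_bar_tuple m n (k k' : {ffun 'I_m -> 'F_p}) j : (j < m)%N -> n.+1 = (2 * m)%N ->
  (forall i, (i < m)%N -> extend 0 k' i = extend 0 k i + (i == j)%:R - (i == j.+1)%:R) ->
  face (2 * j).+2 (bar_tuple n.+1 k') = face (2 * j).+1 (bar_tuple n.+1 k).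
Proof.
move=> j_m n_m k'E; apply/ffunP=> i; have i_n := ltn_ord i.
have wordE l : (l < n.+1)%N -> bar_tuple n.+1 k (inord l) = bar_word (extend 0 k) l.
  by move=> l_n; rewrite ffunE inordK.
have wordE' l : (l < n.+1)%N -> bar_tuple n.+1 k' (inord l) = bar_word (extend 0 k') l.
  by move=> l_n; rewrite ffunE inordK.
have word_eq l : (l < n.+1)%N -> l != (2 * j)%N -> l != (2 * j).+2 ->
    bar_word (extend 0 k') l = bar_word (extend 0 k) l.
  move=> l_n l1 l2; rewrite /bar_word; case: ifP => // odd_l.
  rewrite k'E; last by lia.
  have -> : (l./2 == j) = false by lia.
  have -> : (l./2 == j.+1) = false by lia.
  by rewrite addr0 subr0.
rewrite [LHS]ffunE [RHS]ffunE !wordE ?wordE'; try lia.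
rewrite !ltnS !eqSS; case: (ltngtP i (2 * j)) => ij.
- by rewrite word_eq //; lia.
- case: (ltngtP i (2 * j).+1) => ij'; try lia.
    by rewrite word_eq //; lia.
  have j1_m : (j.+1 < m)%N by lia.
  rewrite ij' /bar_word /= !oddM /= !mul2n !doubleK k'E //.
  rewrite eqxx (gtn_eqF (ltnSn j)) addr0.
  by rewrite -{1}expg_Fp1 -expg_Fp_add addrC subrK.
- rewrite ij /bar_word /= oddM /= !mul2n !doubleK k'E //.
  by rewrite eqxx (ltn_eqF (ltnSn j)) subr0 expg_Fp_add expg_Fp1.
Qed.

(** The face 0 deletes the only entry that involves k_0, so the summand is invariant under
    translation of k_0, which has order p and no fixed point. *)
Lemma sum_bar_tuple_face0 m n (f : cochain gT 'F_p n) : (0 < m)%N ->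
  \sum_(k : {ffun 'I_m -> 'F_p}) f (face 0 (bar_tuple n.+1 k)) = 0.
Proof.
case: m => // m _; pose d : {ffun 'I_m.+1 -> 'F_p} := [ffun i => (i == ord0)%:R].
have iter_d l k : iter l (fun k : {ffun 'I_m.+1 -> 'F_p} => k + d) k = k + d *+ l.
  by elim: l => [|l IHl]; rewrite ?addr0 //= IHl mulrSr addrA.
rewrite (sum_fixed_points p_pr (s := fun k : {ffun 'I_m.+1 -> 'F_p} => k + d)).
- apply: big1 => k /eqP/(congr1 (fun k : {ffun 'I_m.+1 -> 'F_p} => k ord0)).
  rewrite !ffunE eqxx => /eqP; rewrite -[X in _ == X]addr0.
  by rewrite (inj_eq (addrI _)) oner_eq0.
- move=> k; rewrite iter_d; apply/ffunP=> i.
  by rewrite !ffunE ffunMnE (mulrn_pchar (pchar_Fp p_pr)) addr0.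
move=> k; congr (f _); apply/ffunP=> i; have i_n := ltn_ord i; rewrite !ffunE.
rewrite /= inordK // /bar_word; case: ifP => // even_i.
congr (u ^+ nat_of_ord _)%g; rewrite /extend.
case: insubP => //= l _ lE; rewrite !ffunE -val_eqE /=.
have -> : (l == 0%N :> nat) = false by rewrite lE; lia.
by rewrite mulr0n addr0.
Qed.

Lemma alternating_sum_pairs (A : zmodType) m (S : nat -> A) :
  (forall j, (j < m)%N -> S (2 * j).+1 = S (2 * j).+2) ->
  \sum_(j < (2 * m).+1) S j *~ (-1) ^+ j = S 0%N.
Proof.
elim: m => [|m IHm] S_eq; first by rewrite muln0 big_ord1.
rewrite mulnS 2!big_ord_recr /= IHm; last by move=> j j_m; rewrite S_eq // ltnW.
by rewrite !add2n S_eq // !exprS !mulN1r opprK mulrNz addrNK.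
Qed.

(** The chain is a mod p cycle: after a translation of k the faces 2j+1 and 2j+2 cancel, and the
    face 0 sums to zero. *)
Lemma sum_bar_tuple_differential m n (f : cochain gT 'F_p n) :
  (0 < m)%N -> n.+1 = (2 * m)%N ->
  \sum_(k : {ffun 'I_m -> 'F_p}) differential f (bar_tuple n.+1 k) = 0.
Proof.
move=> m_gt0 n_m.
under eq_bigr do rewrite ffunE.
rewrite exchange_big /=.
under eq_bigr do rewrite -mulrz_suml.
pose S j := \sum_(k : {ffun 'I_m -> 'F_p}) f (face j (bar_tuple n.+1 k)).
have := @alternating_sum_pairs _ m S; rewrite -n_m => ->.
  exact: sum_bar_tuple_face0.
move=> j j_m; rewrite /S.
pose d : {ffun 'I_m -> 'F_p} := [ffun i : 'I_m => (i == j :> nat)%:R - (i == j.+1 :> nat)%:R].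
rewrite [RHS](reindex_inj (addIr d)); apply: eq_bigr => k _; congr (f _).
apply/esym/face_bar_tuple => // i i_m.
by rewrite -[i]/(val (Ordinal i_m)) !extend_ord !ffunE addrA.
Qed.

Lemma sum_ffun_recr (T : finType) (A : nmodType) m (H : {ffun 'I_m.+1 -> T} -> A) :
  \sum_k H k =
  \sum_(k : {ffun 'I_m -> T}) \sum_a H [ffun i => oapp k a (unlift ord_max i)].
Proof.
rewrite pair_bigA /= (reindex (fun ka : {ffun 'I_m -> T} * T =>
  [ffun i => oapp ka.1 ka.2 (unlift ord_max i)])) //.
exists (fun k : {ffun 'I_m.+1 -> T} => ([ffun i => k (lift ord_max i)], k ord_max)) => [[k a]|k] _ /=.
  congr pair; last by rewrite ffunE unlift_none.
  by apply/ffunP=> i; rewrite !ffunE liftK.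
by apply/ffunP=> i; rewrite ffunE; case: unliftP => [j|] -> //=; rewrite ffunE.
Qed.

Variables (X : finType) (to : X -> gT -> X) (c : X -> gT -> 'F_p).
Hypothesis to1 : forall x, to x 1%g = x.
Hypothesis toM : forall x g h, to x (g * h)%g = to (to x g) h.
Hypothesis cM : forall x g h, c x (g * h)%g = c x g + c (to x g) h.

(** The carry cocycle, pulled back at the base point x, paired with the 2-chain of all (u^a, u). *)
Definition orbit_carry x : nat :=
  \sum_(a : 'F_p) carry (c x (u ^+ a)%g) (c (to x (u ^+ a)%g) u).

(* The carries telescope along the cyclic group of u. *)
Lemma orbit_carryE x : (p * orbit_carry x = \sum_(a : 'F_p) c (to x (u ^+ a)%g) u)%N.
Proof.
apply: (@addnI (\sum_(a : 'F_p) (c x (u ^+ a)%g : nat))).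
rewrite -[in RHS]big_split /=.
under [RHS]eq_bigr => a _.
  rewrite (carryP p_pr) -cM -[X in (_ ^+ _ * X)%g]expg_Fp1 -expg_Fp_add; over.
rewrite big_split /= -big_distrr /= addnC; congr (_ + _)%N.
exact: (reindex_inj (addIr 1)).
Qed.

(** Checked after multiplication by p in [nat], where [orbit_carryE] gives a sum over all translates
    of x by powers of u. *)
Lemma orbit_carry_to x : orbit_carry (to x u) = orbit_carry x.
Proof.
apply/eqP; rewrite -(eqn_pmul2l (prime_gt0 p_pr)) !orbit_carryE; apply/eqP.
rewrite [RHS](reindex_inj (addrI 1)); apply: eq_bigr => a _.
by rewrite -toM expg_Fp_add expg_Fp1.
Qed.

Lemma orbit_carry_word x k i :
  orbit_carry (to x (prefix_prod (bar_word k) i)) = orbit_carry x.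
Proof.
have orbit_carryX l y : orbit_carry (to y (u ^+ l)%g) = orbit_carry y.
  by elim: l => [|l IHl]; rewrite ?to1 // expgSr toM orbit_carry_to.
elim: i => [|i IHi]; first by rewrite /prefix_prod big_ord0 to1.
rewrite prefix_prodS toM /bar_word; case: ifP => _; last by rewrite orbit_carryX.
by rewrite orbit_carry_to.
Qed.

Lemma prefix_prod_bar_word k k' i :
  (forall j, (2 * j < i)%N -> k j = k' j) ->
  prefix_prod (bar_word k) i = prefix_prod (bar_word k') i.
Proof.
move=> kk'; apply: eq_bigr => j _; rewrite /bar_word; case: ifP => // even_j.
by rewrite kk' //; have := ltn_ord j; lia.
Qed.

Lemma labels_bar_word x k k' i :
  (forall j, (2 * j <= i)%N -> k j = k' j) ->
  labels to c x (bar_word k) i = labels to c x (bar_word k') i.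
Proof.
move=> kk'; apply: eq_labels => j j_i; rewrite /bar_word; case: ifP => // even_j.
by rewrite kk' //; lia.
Qed.

(** The m carries start at base points in one u-orbit, where [orbit_carry] is constant, so the sum
    factors; the induction splits off the last exponent. *)
Lemma sum_carry_power_word x m :
  \sum_(k : {ffun 'I_m -> 'F_p}) carry_power m (labels to c x (bar_word (extend 0 k))) =
  (orbit_carry x ^ m)%N.
Proof.
elim: m => [|m IHm].
  rewrite (eq_bigr (fun=> 1%N)) => [|k _]; last by rewrite /carry_power big_ord0.
  by rewrite sum1_card card_ffun !card_ord !expn0.
rewrite sum_ffun_recr expnSr -IHm big_distrl; apply: eq_bigr => k _ /=.
rewrite -(orbit_carry_word x (extend 0 k) (2 * m)) /orbit_carry big_distrr.
apply: eq_bigr => a _ /=; set k' := [ffun i => _].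
have k'E j : (j < m)%N -> extend 0 k' j = extend 0 k j.
  move=> j_m; rewrite -[j in RHS]/(val (Ordinal j_m)) extend_ord.
  have := extend_ord 0 k' (lift ord_max (Ordinal j_m)).
  by rewrite lift_max ffunE liftK.
have k'm : extend 0 k' m = a.
  by rewrite -[m]/(val (@ord_max m)) extend_ord ffunE unlift_none.
rewrite /carry_power big_ord_recr /=; congr (_ * _)%N.
  apply: eq_bigr => j _; have j_m := ltn_ord j.
  by congr carry; apply: labels_bar_word => i i_j; rewrite k'E //; lia.
have wE : bar_word (extend 0 k') (2 * m)%N = (u ^+ a)%g.
  by rewrite /bar_word oddM mul2n doubleK k'm.
rewrite /labels prefix_prodS wE toM (@prefix_prod_bar_word _ (extend 0 k)).
  by rewrite /bar_word /= oddM.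
by move=> j j_m; rewrite k'E //; lia.
Qed.

Lemma orbit_carry_fixed x : to x u = x -> orbit_carry x = c x u.
Proof.
move=> xu; apply/eqP; rewrite -(eqn_pmul2l (prime_gt0 p_pr)) orbit_carryE.
have xX l : to x (u ^+ l)%g = x.
  by elim: l => // l IHl; rewrite expgS toM xu.
under eq_bigr do rewrite xX.
by rewrite sum_nat_const card_Fp.
Qed.

(** For each x the sum over k is [orbit_carry x ^ m]. This is u-invariant, so modulo p only the
    fixed points remain. *)
Lemma transfer_pairing m n (h : cochain gT 'F_p n) : n = (2 * m)%N ->
  h = transfer to c n (fun a => (carry_power m a)%:R) ->
  \sum_(k : {ffun 'I_m -> 'F_p}) h (bar_tuple n k) =
  \sum_(x | to x u == x) c x u ^+ m.
Proof.
move=> n_m ->.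
under eq_bigr do rewrite ffunE.
rewrite exchange_big /= (eq_bigr (fun x => (orbit_carry x)%:R ^+ m)) => [|x _].
  rewrite (sum_fixed_points p_pr (s := fun x => to x u)).
  - by apply: eq_bigr => x /eqP xu; rewrite orbit_carry_fixed // natr_Zp.
  - move=> x; suff -> l : iter l (to^~ u) x = to x (u ^+ l)%g by rewrite u_p to1.
    by elim: l => [|l IHl]; rewrite ?to1 //= IHl expgSr toM.
  by move=> x; rewrite orbit_carry_to.
rewrite -natrX -sum_carry_power_word natr_sum; apply: eq_bigr => k _.
congr (_%:R); apply: carry_power_local => i i_m; apply: eq_labels => j j_i.
have j_n : (j < n)%N by lia.
by rewrite -[j]/(val (Ordinal j_n)) extend_ord ffunE.
Qed.

End BarCycle.

Lemma bockstein_transfer_neq0 (p : nat) (p_pr : prime p) (gT : finGroupType)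
    (X : finType) (to : X -> gT -> X) (c : X -> gT -> 'F_p) (u : gT) m :
  (forall x, to x 1%g = x) ->
  (forall x g h, to x (g * h)%g = to (to x g) h) ->
  (forall x g h, c x (g * h)%g = c x g + c (to x g) h) ->
  (u ^+ p = 1)%g -> \sum_(x | to x u == x) c x u ^+ m.+1 != 0 ->
  exists x : 'H^(2 * m).+1(gT; 'F_p), bockstein p_pr x != 0.
Proof.
move=> to1 toM cM u_p sum_neq0.
have [x [h [xh hE]]] := bockstein_transfer p_pr m to1 toM cM; exists x.
rewrite xh; move: sum_neq0.
apply: contraNneq => h0.
have n_m : (2 * m).+2 = (2 * m.+1)%N by lia.
rewrite -(transfer_pairing p_pr u_p to1 toM cM n_m hE).
have /eqP : cohomology_class h = cohomology_class 0.
  by rewrite h0 /cohomology_class raddf0.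
rewrite cohomology_class_eq subr0 coboundaryE => /codomP[f /= ->].
by rewrite (sum_bar_tuple_differential p_pr u_p f).
Qed.

(** * The GL_n-set of pairs (v, w mod v) and its cocycle *)

Section NormalizedPairs.

Variables (F : finFieldType) (n : nat).
Implicit Types (v w : 'rV[F]_n.+1) (g : {'GL_n.+1[F]}).

(* The representative of w modulo v is the one whose entry at the first      *)
(* nonzero entry of v vanishes. For v = 0 the slope is 0 since 0^-1 = 0, so   *)
(* such pairs are harmless: they never have a nonzero pair_slope.             *)
Definition pivot v : 'I_n.+1 := odflt ord0 [pick i | v 0 i != 0].

Definition slope v w : F := w 0 (pivot v) / v 0 (pivot v).

Lemma pivot_neq0 v : v != 0 -> v 0 (pivot v) != 0.
Proof.
rewrite /pivot; case: pickP => //= v0 /eqP[].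
by apply/rowP=> i; rewrite mxE; move/negbFE/eqP: (v0 i).
Qed.

Lemma slope0l w : slope 0 w = 0.
Proof. by rewrite /slope mxE invr0 mulr0. Qed.

Lemma slopeB v w a : v != 0 -> slope v (w - a *: v) = slope v w - a.
Proof. by move=> /pivot_neq0 v0; rewrite /slope !mxE mulrBl mulfK. Qed.

Definition normalized_pair := {x : 'rV[F]_n.+1 * 'rV[F]_n.+1 | slope x.1 x.2 == 0}.

Lemma normalize_subproof v w : slope v (w - slope v w *: v) == 0.
Proof.
have [->|v0] := eqVneq v 0; first by rewrite slope0l.
by rewrite slopeB // subrr.
Qed.

Definition normalize v w : normalized_pair :=
  exist _ (v, w - slope v w *: v) (normalize_subproof v w).

Definition pair_act (x : normalized_pair) g : normalized_pair :=
  normalize ((val x).1 *m GLval g) ((val x).2 *m GLval g).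

Definition pair_slope (x : normalized_pair) g : F :=
  slope ((val x).1 *m GLval g) ((val x).2 *m GLval g).

Lemma val_pair_act x g :
  val (pair_act x g) = ((val x).1 *m GLval g,
    (val x).2 *m GLval g - pair_slope x g *: ((val x).1 *m GLval g)).
Proof. by []. Qed.

Lemma pair_act1 x : pair_act x 1%g = x.
Proof.
apply/val_inj; case: x => -[v w] /= /eqP vw0.
by rewrite !mulmx1 vw0 scale0r subr0.
Qed.

Lemma slope_mulmx v w a g :
  slope (v *m GLval g) ((w - a *: v) *m GLval g) =
  slope (v *m GLval g) (w *m GLval g) - (if v == 0 then 0 else a).
Proof.
have [->|v0] := eqVneq v 0; first by rewrite mul0mx !slope0l subrr.
rewrite mulmxBl -scalemxAl slopeB //; apply: contra_neq v0 => vg0.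
by rewrite -[v](mulmxK (GL_unitmx g)) vg0 mul0mx.
Qed.

(** For v nonzero, normalizing after g subtracts [pair_slope x g] times vg, which lowers the slope
    after h by that same amount. *)
Lemma pair_slopeM x g h :
  pair_slope x (g * h)%g = pair_slope x g + pair_slope (pair_act x g) h.
Proof.
case: x => -[v w] vw0; rewrite /pair_slope GL_MxE /= slope_mulmx !mulmxA.
case: eqP => [->|_]; last by rewrite addrC subrK.
by rewrite mul0mx !slope0l add0r subr0.
Qed.

Lemma pair_actM x g h : pair_act x (g * h)%g = pair_act (pair_act x g) h.
Proof.
apply/val_inj; rewrite !val_pair_act pair_slopeM GL_MxE /= !mulmxA.
by rewrite mulmxBl -scalemxAl scalerDl opprD addrA.
Qed.

End NormalizedPairs.

(** * The Jordan block and its fixed pairs *)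

Section RegularUnipotent.

Variables (p n : nat).
Hypothesis p_pr : prime p.
Hypothesis n_p : (n.+2 <= p)%N.

Definition jordan_nilpotent : 'M['F_p]_n.+2 := \matrix_(i, j) (i == j.+1 :> nat)%:R.

Lemma jordan_nilpotentX k i j :
  (jordan_nilpotent ^+ k) i j = (i == (j + k)%N :> nat)%:R.
Proof.
elim: k j => [|k IHk] j; first by rewrite expr0 mxE addn0.
rewrite exprSr mxE.
under eq_bigr => l _ do rewrite IHk mxE -natrM mulnb.
have [j1_n|j1_n] := ltnP j.+1 n.+2.
  rewrite (bigD1 (Ordinal j1_n)) //= big1 => [|l]; last first.
    by rewrite -val_eqE /= => /negbTE->; rewrite andbF.
  by rewrite eqxx andbT addr0 addSnnS.
rewrite big1 => [|l _]; first by rewrite ltn_eqF //; have := ltn_ord i; lia.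
by rewrite [l == _ :> nat]ltn_eqF ?andbF // (leq_trans (ltn_ord l)).
Qed.

(** In characteristic p, (1 + N)^p = 1 + N^p, and N^p = 0 because the size is at most p. *)
Lemma jordan_block_exp : (1 + jordan_nilpotent) ^+ p = 1.
Proof.
have p_char : p \in [pchar 'M['F_p]_n.+2] by rewrite pchar_lalg pchar_Fp.
rewrite -[LHS](pFrobenius_autE p_char) pFrobenius_autD_comm; last exact: commr_sym (commr1 _).
rewrite !pFrobenius_autE expr1n [X in _ + X](_ : _ = 0) ?addr0 //.
apply/matrixP=> i j; rewrite jordan_nilpotentX mxE ltn_eqF //.
by rewrite (leq_trans (ltn_ord i)) // (leq_trans n_p) // leq_addl.
Qed.

Lemma jordan_block_unit : 1 + jordan_nilpotent \is a GRing.unit.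
Proof. by rewrite -(unitrX_pos _ (prime_gt0 p_pr)) jordan_block_exp unitr1. Qed.

Definition jordan_block : {'GL_n.+2['F_p]} := FinRing.Unit jordan_block_unit.

Lemma jordan_block_order : (jordan_block ^+ p = 1)%g.
Proof. by apply/val_inj; rewrite FinRing.val_unitX /= jordan_block_exp. Qed.

Lemma mul_jordan_block (v : 'rV['F_p]_n.+2) (j : 'I_n.+2) :
  (v *m GLval jordan_block) 0 j =
  v 0 j + (if (j.+1 < n.+2)%N then v 0 (inord j.+1) else 0).
Proof.
rewrite mulmxDr mulmx1 !mxE; congr (_ + _).
under eq_bigr => l _ do rewrite mxE mulr_natr mulrb.
rewrite -big_mkcond /=; case: ifP => j1_n; last first.
  by rewrite big1 // => l /eqP lE; rewrite -lE ltn_ord in j1_n.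
by rewrite (big_pred1 (inord j.+1)) // => l /=; rewrite -val_eqE /= inordK.
Qed.

Definition basis_pair (ab : 'F_p * 'F_p) : normalized_pair 'F_p n.+1 :=
  normalize (ab.1 *: delta_mx 0 0) (ab.2 *: delta_mx 0 1).

Definition pair_coords (x : normalized_pair 'F_p n.+1) : 'F_p * 'F_p :=
  ((val x).1 0 0, (val x).2 0 1).

Lemma pivot_delta (a : 'F_p) : pivot (a *: delta_mx 0 0 : 'rV_n.+2) = 0.
Proof.
rewrite /pivot; case: pickP => //= i; rewrite !mxE /=.
by have [->|_] := eqVneq i 0; rewrite ?mulr0 ?eqxx.
Qed.

Lemma slope_delta (a : 'F_p) w : slope (a *: delta_mx 0 0 : 'rV_n.+2) w = w 0 0 / a.
Proof. by rewrite /slope pivot_delta !mxE !eqxx mulr1. Qed.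

Lemma val_basis_pair ab :
  val (basis_pair ab) = (ab.1 *: delta_mx 0 0, ab.2 *: delta_mx 0 1).
Proof. by rewrite /= slope_delta !mxE mulr0 mul0r scale0r subr0. Qed.

Lemma basis_pairK : cancel basis_pair pair_coords.
Proof. by case=> a b; rewrite /pair_coords val_basis_pair !mxE !eqxx !mulr1. Qed.

Lemma mul_delta0_jordan a :
  a *: delta_mx 0 0 *m GLval jordan_block = a *: delta_mx 0 0 :> 'rV_n.+2.
Proof.
apply/rowP=> j; rewrite mul_jordan_block !mxE; case: ifP => j1_n; rewrite ?addr0 //.
by rewrite -[inord _ == _]val_eqE /= inordK // mulr0 addr0.
Qed.

Lemma mul_delta1_jordan a :
  a *: delta_mx 0 1 *m GLval jordan_block =
  a *: delta_mx 0 1 + a *: delta_mx 0 0 :> 'rV_n.+2.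
Proof.
apply/rowP=> j; rewrite mul_jordan_block !mxE; congr (_ + _).
case: ifP => j1_n; last first.
  have [j0|_] := eqVneq j 0; first by rewrite j0 in j1_n.
  by rewrite andbF mulr0.
by rewrite -[inord _ == _]val_eqE /= inordK.
Qed.

Lemma pair_slope_basis ab : pair_slope (basis_pair ab) jordan_block = ab.2 / ab.1.
Proof.
rewrite /pair_slope val_basis_pair /= mul_delta0_jordan mul_delta1_jordan.
by rewrite slope_delta !mxE !eqxx mulr0 add0r mulr1.
Qed.

Lemma basis_pair_fixed ab : ab.1 != 0 ->
  pair_act (basis_pair ab) jordan_block = basis_pair ab.
Proof.
move=> a0; apply/val_inj; rewrite val_pair_act pair_slope_basis val_basis_pair /=.
rewrite mul_delta0_jordan mul_delta1_jordan; congr pair.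
by rewrite scalerA divfK // addrK.
Qed.

(** With N = u - 1 and c the slope, being fixed means v N = 0 and w N = c v. The first gives v = a
    e_0, the second puts w in the span of e_0 and e_1, and normalization kills the e_0 part. *)
Lemma fixed_pairP x : pair_act x jordan_block = x -> pair_slope x jordan_block != 0 ->
  basis_pair (pair_coords x) = x.
Proof.
case: x => -[v w] /= vw0 xu c0; apply/val_inj; rewrite val_basis_pair /=.
have := congr1 val xu; rewrite val_pair_act /=.
set c := pair_slope _ _ in c0 *; move=> [vu wu]; rewrite vu in wu.
have entryS (x : 'rV['F_p]_n.+2) (j : 'I_n.+2) : j != 0 ->
    exists2 j' : 'I_n.+2, j' = j.-1 :> nat & (x *m GLval jordan_block) 0 j' = x 0 j' + x 0 j.
  move=> j0; have j_n := ltn_ord j; have {}j0 : (0 < j)%N by rewrite lt0n.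
  exists (inord j.-1); first by rewrite inordK //; lia.
  rewrite mul_jordan_block inordK ?prednK ?j_n //; last by rewrite ltnW.
  by rewrite inord_val.
have vS (j : 'I_n.+2) : j != 0 -> v 0 j = 0.
  move=> /(entryS v)[j' _]; rewrite vu => /eqP.
  by rewrite -[X in X == _]addr0 (inj_eq (addrI _)) => /eqP.
have wS (j : 'I_n.+2) : j != 0 -> exists2 j' : 'I_n.+2, j' = j.-1 :> nat & w 0 j = c * v 0 j'.
  move=> /(entryS w)[j' j'E wj]; exists j' => //.
  apply: (addrI (w 0 j')); rewrite -wj -{2}wu !mxE; ring.
have v_delta : v = v 0 0 *: delta_mx 0 0.
  apply/rowP=> j; rewrite !mxE eqxx /=.
  by have [->|j0] := eqVneq j 0; rewrite ?mulr1 // mulr0 vS.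
(* Otherwise v = 0, and the slope would be 0 by convention. *)
have v0 : v 0 0 != 0.
  apply: contraNneq c0 => v00.
  by rewrite /c /pair_slope /= v_delta v00 scale0r mul0mx slope0l.
have w0 : w 0 0 = 0.
  by have := vw0; rewrite /= v_delta slope_delta mulf_eq0 invr_eq0 (negbTE v0) orbF => /eqP.
congr pair => //; apply/rowP=> j; rewrite !mxE eqxx /=.
have [->|j1] := eqVneq j 1; first by rewrite mulr1.
rewrite mulr0; have [->//|j0] := eqVneq j 0.
have [j' j'E ->] := wS j j0; rewrite vS ?mulr0 //.
move: j0 j1; rewrite -!val_eqE /= j'E ?modn_small //; lia.
Qed.

Lemma card_Fp_pairs : #|[pred ab : 'F_p * 'F_p | (ab.1 != 0) && (ab.2 != 0)]|%:R = 1 :> 'F_p.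
Proof.
rewrite (eq_card (B := predX (predC1 0) (predC1 0))) => [|ab]; last by rewrite !inE.
rewrite cardX cardC1 card_Fp // natrM -subn1 natrB ?prime_gt0 //.
by rewrite pchar_Fp_0 // sub0r mulrNN mulr1.
Qed.

Lemma sum_pair_slope :
  \sum_(x | pair_act x jordan_block == x) pair_slope x jordan_block ^+ p.-1 = 1.
Proof.
have fermat (a : 'F_p) : a ^+ p.-1 = (a != 0)%:R.
  have p1_gt0 : (0 < p.-1)%N by have := prime_gt1 p_pr; lia.
  have [->|a0] := eqVneq a 0; first by rewrite expr0n gtn_eqF.
  apply: (mulfI a0); rewrite -exprS prednK ?prime_gt0 // mulr1.
  by have := expf_card a; rewrite card_Fp.
under eq_bigr do rewrite fermat mulrb.
rewrite -big_mkcondr /=.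
rewrite (reindex_onto basis_pair pair_coords) => [|x /andP[/eqP]]; last exact: fixed_pairP.
rewrite -[RHS]card_Fp_pairs -sum1_card natr_sum; apply: eq_bigl => -[a b].
rewrite basis_pairK eqxx andbT pair_slope_basis !inE /=.
(* For a = 0 the slope b / 0 is 0, so both conditions fail. *)
have [->|a0] := eqVneq a 0; first by rewrite invr0 mulr0 eqxx andbF.
by rewrite basis_pair_fixed // eqxx mulf_eq0 invr_eq0 (negbTE a0) orbF.
Qed.

End RegularUnipotent.

Lemma cohomology_cast_eq0 (gT : finGroupType) (A : finZmodType) m n (e : m = n)
  (x : 'H^m(gT; A)) : (cohomology_cast e x == 0) = (x == 0).
Proof. by case: n / e. Qed.

Theorem mainTheorem2 (p n : nat) (p_pr : prime p) (hn : (2 <= n <= p)%N) :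
  exists (x : 'H^(2 * p - 3)({'GL_n['F_p]}; 'F_p))
         (y : 'H^(2 * p - 2)({'GL_n['F_p]}; 'F_p)),
    [/\ x != 0, y != 0 &
        y = cohomology_cast (bockstein_degree p_pr) (bockstein p_pr x)].
Proof.
suff [x bx] : exists x : 'H^(2 * p - 3)({'GL_n['F_p]}; 'F_p), bockstein p_pr x != 0.
  exists x, (cohomology_cast (bockstein_degree p_pr) (bockstein p_pr x)).
  split; rewrite ?cohomology_cast_eq0 //.
  by apply: contraNneq bx => ->; rewrite raddf0.
have := prime_gt1 p_pr => p_gt1.
(* Here m = p-2, so that the exponent m+1 in the pairing is p-1. *)
have -> : (2 * p - 3 = (2 * p.-2).+1)%N by lia.
case: n hn => [|[|n]] // n_p.
apply: (bockstein_transfer_neq0 p_pr (@pair_act1 _ _) (@pair_actM _ _)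
  (@pair_slopeM _ _) (jordan_block_order p_pr n_p)).
have -> : p.-2.+1 = p.-1 by lia.
by rewrite sum_pair_slope // oner_eq0.
Qed.
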